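(* Let $a_i,b_i>0$, $\eta\in[0,1)$, $T>0$ and $W_i,W_j>0$ be fixed, and suppose $\Delta_i=\Delta_j$. Then the dictator's optimal choice $s^*\in[0,1]$ weakly increases when the common value $\Delta_i=\Delta_j$ decreases. That is, for $\Delta\in\mathbb{R}$ let $s^*(\Delta)$ denote the maximizer over $s\in[0,1]$ of the dictator's utility $U_i^D(s)$ (defined in the context) with $\Delta_i=\Delta_j=\Delta$; then $\Delta'\le\Delta$ implies $s^*(\Delta')\ge s^*(\Delta)$.
   Context: Setting: a Dictator Game with a dictator $i$ and a recipient $j$. $W_i,W_j>0$ are the two individuals' sums of wages over two sub-periods, and $\Delta_i,\Delta_j\in\mathbb{R}$ are the differences between their second and first sub-period wages. The dictator chooses $s\in[0,1]$, keeping the share $s$ of a tax account $T>0$ and giving the share $1-s$ to the recipient. The parameters $a_i,b_i>0$ are the weights on personal and social concerns, and $\eta\in[0,1)$ is the loss-aversion parameter. The dictator's utility, as a function of $s$, is $$ U_i^D(s)=\begin{cases} a_i\big(W_i+sT+\eta(\Delta_i+sT)\big)-b_i\Big[\big(\tfrac12(W_i-W_j+2sT-T)\big)^2+\big(\tfrac12(\Delta_i-\Delta_j+2sT-T)\big)^2\Big] & \text{if } \Delta_i+sT<0,\\[1mm] a_i(W_i+sT)-b_i\Big[\big(\tfrac12(W_i-W_j+2sT-T)\big)^2+\big(\tfrac12(\Delta_i-\Delta_j+2sT-T)\big)^2\Big] & \text{if } \Delta_i+sT\ge 0. \end{cases} $$ *)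

(* Defs.v *)
From mathcomp Require Import all_boot all_order all_algebra.
From mathcomp Require Import reals.
Set Implicit Arguments.
Unset Strict Implicit.
Unset Printing Implicit Defensive.
Import Order.TTheory GRing.Theory Num.Theory.
Local Open Scope ring_scope.

Definition inequality_loss (R : realType) (T Wi Wj Di Dj s : R) : R :=
  (2^-1 * (Wi - Wj + 2 * s * T - T)) ^+ 2
  + (2^-1 * (Di - Dj + 2 * s * T - T)) ^+ 2.

(* Utility of dictator i who keeps the share s of the tax account T: W are
   total wages and D is the second sub-period wage minus the first; a and b
   weigh personal and social concerns; eta is the loss-aversion parameter. *)
Definition dictator_utility (R : realType)
    (a b eta T Wi Wj Di Dj s : R) : R :=
  if Di + s * T < 0 then
    a * (Wi + s * T + eta * (Di + s * T))
    - b * inequality_loss T Wi Wj Di Dj s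
  else
    a * (Wi + s * T) - b * inequality_loss T Wi Wj Di Dj s.

Definition optimal_choice (R : realType) (U : R -> R) (s : R) : Prop :=
  s \in `[0, 1] /\ (forall t : R, t \in `[0, 1] -> U t <= U s).

(* Main.v *)
Require Import Defs.
From mathcomp Require Import all_boot all_order all_algebra.
From mathcomp Require Import reals.
From mathcomp Require Import ring lra.
Import Order.TTheory GRing.Theory Num.Theory.
Local Open Scope ring_scope.

(** When the two wage differences agree, the inequality loss does not depend on
    them, so up to a constant and the factor [2 b T^2] the utility is the
    strictly concave function [- (s - v)^2 + 2 (u - v) min(0, s - k)], where [v]
    and [u >= v] are the vertices of the parabolas on the gain and loss sides
    and [k = - D / T] is the kink. Its maximizer over [[0, 1]] is [k] clamped to
    [[v, u]] and then to [[0, 1]], which is monotone in [k], hence in [- D]. *)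

Definition clamp (R : realDomainType) (x y z : R) : R :=
  Num.max x (Num.min y z).

Lemma clamp_homo (R : realDomainType) (x y : R) :
  {homo clamp R x y : z z' / z <= z'}.
Proof.
by move=> z z' zz'; rewrite /clamp le_max2 // le_min2.
Qed.

(* Half of [f t + (t - m) ^+ 2 <= f m], expanded, for
   [f s = - (s - v) ^+ 2 + 2 * (u - v) * Num.min 0 (s - k)]. *)
Lemma clamp_variational (R : realFieldType) (u v k t : R)
    (m := clamp R 0 1 (clamp R v u k)) :
  v <= u -> 0 <= t <= 1 ->
  (t - m) * (v - m) + (u - v) * (Num.min 0 (t - k) - Num.min 0 (m - k)) <= 0.
Proof.
move=> vu /andP[t0 t1]; rewrite {}/m /clamp.
have [uk|ku] := leP u k; have [?|?] := leP v _;
  have [?|?] := leP 1 _; have [?|?] := leP 0 _;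
  have [?|?] := leP 0 (t - k); have [?|?] := leP 0 (_ - k);
  try lra; nra.
Qed.

(** A maximizer [s] satisfies [U s + c * (s - m) ^+ 2 <= U m <= U s], which forces [s = m]. *)
Lemma optimal_choice_unique (R : realType) (U : R -> R) (c m : R) :
  0 < c -> m \in `[0, 1] ->
  (forall t, t \in `[0, 1] -> U t + c * (t - m) ^+ 2 <= U m) ->
  forall s, optimal_choice U s <-> s = m.
Proof.
move=> c0 m01 Um s; split=> [[s01 Us]|->]; last first.
  by split=> // t /Um; apply: le_trans; rewrite lerDl mulr_ge0 ?sqr_ge0 ?ltW.
have := le_trans (Um s s01) (Us m m01).
rewrite gerDl pmulr_rle0 // => sm_le0.
by apply/eqP; rewrite -subr_eq0 -sqrf_eq0 eq_le sm_le0 sqr_ge0.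
Qed.

Lemma dictator_utilityE (R : realType) (a b eta T Wi Wj Di Dj s : R) :
  dictator_utility a b eta T Wi Wj Di Dj s =
  a * (Wi + s * T + eta * Num.min 0 (Di + s * T))
  - b * inequality_loss T Wi Wj Di Dj s.
Proof.
by rewrite /dictator_utility; case: ltP => // _; rewrite mulr0 addr0.
Qed.

Theorem proposition3 (R : realType) (a b eta T Wi Wj : R)
    (a_gt0 : 0 < a) (b_gt0 : 0 < b) (eta_ge0 : 0 <= eta) (eta_lt1 : eta < 1)
    (T_gt0 : 0 < T) (Wi_gt0 : 0 < Wi) (Wj_gt0 : 0 < Wj) :
  exists sstar : R -> R,
    (forall D s : R,
       optimal_choice (dictator_utility a b eta T Wi Wj D D) s
       <-> s = sstar D)
    /\ (forall D D' : R, D' <= D -> sstar D <= sstar D').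
Proof.
(* The zero in [s] of the utility's derivative when the marginal personal gain is
   [a * (1 + e) * T]. *)
pose vertex e : R := (a * (1 + e) / b - (Wi - Wj) + 2 * T) / (4 * T).
set v := vertex 0; set u := vertex eta.
have [b0 T0] : b != 0 /\ T != 0 by rewrite !gt_eqF.
have uvE : u - v = a * eta / (4 * b * T).
  by rewrite /u /v /vertex; field; rewrite b0 T0.
have vu : v <= u.
  by rewrite -subr_ge0 uvE !mulr_ge0 ?invr_ge0 ?mulr_ge0 // ltW.
exists (fun D => clamp R 0 1 (clamp R v u (- D / T))); split; last first.
  by move=> D D' DD'; do 2!apply: clamp_homo; rewrite ler_pM2r ?invr_gt0 ?lerN2.
move=> D; set k := - D / T; set m := clamp _ _ _ _.
have c0 : 0 < 2 * b * T ^+ 2 by rewrite !mulr_gt0 ?exprn_gt0.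
apply: (optimal_choice_unique _ _ (2 * b * T ^+ 2)) => //.
  by rewrite in_itv /= /m /clamp le_max lexx ge_max ler01 ge_min lexx.
move=> t; rewrite in_itv /= => t01.
have kinkE s : Num.min 0 (D + s * T) = T * Num.min 0 (s - k).
  rewrite minr_pMr ?ltW // mulr0; congr (Num.min _ _).
  by rewrite /k; field.
rewrite -subr_le0 !dictator_utilityE !kinkE /inequality_loss.
have := clamp_variational R u v k t vu t01; rewrite -/m uvE.
set p := Num.min _ (t - k); set q := Num.min _ (m - k).
(* The factor 2 undoes the halving in [clamp_variational]; both left-hand sides then agree for
   arbitrary [p] and [q]. *)
rewrite -(pmulr_rle0 _ (mulr_gt0 (ltr0Sn R 1) c0)); congr (_ <= 0).
by rewrite /v /vertex; field; rewrite b0 T0.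
Qed.
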